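(* Let $a_1,a_2,a_3,a_4,x_1,x_2,x_3,x_4$ be nonzero complex numbers, $K:=a_1a_2a_3a_4$, and $\mathcal E_0:=(a_1-a_2a_4/a_3)(a_1-a_2a_3/a_4)$. Then for every integer $n\ge0$ (whenever no denominator vanishes) $$\mathcal E_0\sum_{k=0}^{n-1}q^{k-1}\frac{(a_1^2/q,a_2^2/q;q)_k(x_1^2;q^2)_k}{(K/(a_3^2q),K/(a_4^2q);q)_{k+1}(x_1x_3x_4/x_2;q^2)_k}=1-\frac{(a_1^2/q,a_2^2/q;q)_n(x_1^2;q^2)_n}{(K/(a_3^2q),K/(a_4^2q);q)_n(x_1x_3x_4/x_2;q^2)_n}$$ $$-x_1(x_1-x_3x_4/x_2)\sum_{k=0}^{n-1}q^{2k}\frac{(a_1^2/q,a_2^2/q;q)_{k+1}(x_1^2;q^2)_k}{(K/(a_3^2q),K/(a_4^2q);q)_{k+1}(x_1x_3x_4/x_2;q^2)_{k+1}}.$$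
   Context: $q$ is a nonzero complex number with $|q|<1$. For a base $p$ and integer $k\ge0$, $(z;p)_k:=\prod_{j=0}^{k-1}(1-zp^j)$, and $(z_1,\dots,z_m;p)_k:=(z_1;p)_k\cdots(z_m;p)_k$. *)

(* Defs.v *)
From mathcomp Require Import all_boot all_order all_algebra.
From mathcomp Require Import complex reals.

Set Implicit Arguments.
Unset Strict Implicit.
Unset Printing Implicit Defensive.

Import GRing.Theory.
Local Open Scope ring_scope.

(* q-shifted factorial (z; p)_k *)
Definition qpoch (F : comNzRingType) (z p : F) (k : nat) : F :=
  \prod_(j < k) (1 - z * p ^+ j).

(* (z_1, ..., z_m; p)_k *)
Definition qpochs (F : comNzRingType) (zs : seq F) (p : F) (k : nat) : F :=
  \prod_(z <- zs) qpoch z p k.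

(* Main.v *)
Require Import Defs.
From mathcomp Require Import all_boot all_order all_algebra.
From mathcomp Require Import complex reals ring.

Import Order.TTheory GRing.Theory Num.Theory.
Local Open Scope ring_scope.
Local Open Scope complex_scope.

(** Abel summation: with U_k = (A,B;q)_k / (C,D;q)_k and
    V_k = (X;q^2)_k / (Y;q^2)_k, telescope
    U_k V_k - U_(k+1) V_(k+1) = (U_k - U_(k+1)) V_k + U_(k+1) (V_k - V_(k+1)).
    Both differences factor: the second because V has a single parameter above
    and below, the first because the balancing condition A B = C D leaves only
    the linear term (A + B - C - D) q^k of
    (1 - C q^k) (1 - D q^k) - (1 - A q^k) (1 - B q^k). *)

Lemma qpochS (F : comNzRingType) (z p : F) (k : nat) :
  qpoch z p k.+1 = qpoch z p k * (1 - z * p ^+ k).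
Proof. by rewrite /qpoch big_ord_recr. Qed.

Lemma qpochs2 (F : comNzRingType) (y z p : F) (k : nat) :
  qpochs [:: y; z] p k = qpoch y p k * qpoch z p k.
Proof. by rewrite /qpochs !big_cons big_nil mulr1. Qed.

(** Free parameters tied only by the balancing condition; the telescoping is run as induction on
    [n]. Every denominator divides one at index [n], since [k.+1 <= n]. *)
Lemma balanced_qpoch_abel_sum (F : fieldType) (q A B C D X Y : F) (n : nat) :
  A * B = C * D ->
  qpochs [:: C; D] q n != 0 -> qpoch Y (q ^+ 2) n != 0 ->
  (A + B - C - D) * (\sum_(0 <= k < n)
     q ^+ k * ((qpochs [:: A; B] q k * qpoch X (q ^+ 2) k)
               / (qpochs [:: C; D] q k.+1 * qpoch Y (q ^+ 2) k)))
  = 1 - (qpochs [:: A; B] q n * qpoch X (q ^+ 2) n)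
        / (qpochs [:: C; D] q n * qpoch Y (q ^+ 2) n)
    - (X - Y) * (\sum_(0 <= k < n)
        q ^+ (2 * k) * ((qpochs [:: A; B] q k.+1 * qpoch X (q ^+ 2) k)
                        / (qpochs [:: C; D] q k.+1 * qpoch Y (q ^+ 2) k.+1))).
Proof.
move=> balanced; elim: n => [|n IHn].
  move=> _ _; rewrite !big_geq // !qpochs2 /qpoch !big_ord0.
  by rewrite !mulr1 divr1 !mulr0 subr0 subrr.
move=> CDn0 Yn0; rewrite !big_nat_recr //= !mulrDr.
move: CDn0 Yn0 IHn; rewrite !qpochs2 !qpochS !mulf_eq0 !negb_or.
(* Nonvanishing at [n.+1] splits into that at [n], needed by the induction hypothesis, and that of
   each new factor. *)
move=> /andP[/andP[Cn0 Cq0] /andP[Dn0 Dq0]] /andP[Yn0 Yq0].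
move=> /(_ (introT andP (conj Cn0 Dn0)) Yn0) ->.
(* With [(q ^+ 2) ^+ n] turned into [(q ^+ n) ^+ 2], the single atom [Q] carries all dependence on
   [q ^+ n]. *)
move: Cq0 Dq0 Yq0; rewrite -!exprM [(2 * n)%N]mulnC exprM.
move: (q ^+ n) (qpoch A _ _) (qpoch B _ _) (qpoch X _ _) Cn0 Dn0 Yn0.
move: (qpoch C _ _) (qpoch D _ _) (qpoch Y _ _) => c d y Q a b x.
move=> Cn0 Dn0 Yn0 Cq0 Dq0 Yq0.
have first_diff : (A + B - C - D) * Q
    = (1 - C * Q) * (1 - D * Q) - (1 - A * Q) * (1 - B * Q).
  (* Expanding exposes [A * B], so that the balancing condition can be rewritten. *)
  have -> : (1 - A * Q) * (1 - B * Q) = 1 - (A + B) * Q + A * B * Q ^+ 2.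
    by ring.
  by rewrite balanced; ring.
rewrite mulrA first_diff; field.
by rewrite Cn0 Dn0 Yn0 Cq0 Dq0 Yq0.
Qed.

Theorem theorem3p10 (R : realType) (q : R[i]) (hq0 : q != 0) (hq1 : `|q| < 1)
    (a1 a2 a3 a4 x1 x2 x3 x4 : R[i])
    (ha1 : a1 != 0) (ha2 : a2 != 0) (ha3 : a3 != 0) (ha4 : a4 != 0)
    (hx1 : x1 != 0) (hx2 : x2 != 0) (hx3 : x3 != 0) (hx4 : x4 != 0)
    (n : nat) :
  let K := a1 * a2 * a3 * a4 in
  let E0 := (a1 - a2 * a4 / a3) * (a1 - a2 * a3 / a4) in
  qpochs [:: K / (a3 ^+ 2 * q); K / (a4 ^+ 2 * q)] q n != 0 ->
  qpoch (x1 * x3 * x4 / x2) (q ^+ 2) n != 0 ->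
  E0 * (\sum_(0 <= k < n)
          q ^ (k%:Z - 1) *
          ((qpochs [:: a1 ^+ 2 / q; a2 ^+ 2 / q] q k
            * qpoch (x1 ^+ 2) (q ^+ 2) k)
           / (qpochs [:: K / (a3 ^+ 2 * q); K / (a4 ^+ 2 * q)] q k.+1
              * qpoch (x1 * x3 * x4 / x2) (q ^+ 2) k)))
  = 1
    - (qpochs [:: a1 ^+ 2 / q; a2 ^+ 2 / q] q n
       * qpoch (x1 ^+ 2) (q ^+ 2) n)
      / (qpochs [:: K / (a3 ^+ 2 * q); K / (a4 ^+ 2 * q)] q n
         * qpoch (x1 * x3 * x4 / x2) (q ^+ 2) n)
    - x1 * (x1 - x3 * x4 / x2) *
      (\sum_(0 <= k < n)
         q ^+ (2 * k) *
         ((qpochs [:: a1 ^+ 2 / q; a2 ^+ 2 / q] q k.+1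
           * qpoch (x1 ^+ 2) (q ^+ 2) k)
          / (qpochs [:: K / (a3 ^+ 2 * q); K / (a4 ^+ 2 * q)] q k.+1
             * qpoch (x1 * x3 * x4 / x2) (q ^+ 2) k.+1))).
Proof.
move=> K E0 CDn0 Yn0.
(* Both sides equal [(a1 * a2 / q) ^+ 2]. *)
have balanced : a1 ^+ 2 / q * (a2 ^+ 2 / q)
    = K / (a3 ^+ 2 * q) * (K / (a4 ^+ 2 * q)).
  by rewrite /K; field; rewrite hq0 ha3 ha4.
(* The integer exponent is [-1] at [k = 0]; the factor [q^-1] is pulled out to join [E0]. *)
have qn_pred (k : nat) : q ^ (k%:Z - 1) = q^-1 * q ^+ k.
  by rewrite expfzDr // mulrC.
under eq_bigr => k _ do rewrite qn_pred -mulrA.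
rewrite -big_distrr /= mulrA.
(* The cross terms of [E0] are [K / a3 ^+ 2] and [K / a4 ^+ 2]. *)
have -> : E0 / q = a1 ^+ 2 / q + a2 ^+ 2 / q
    - K / (a3 ^+ 2 * q) - K / (a4 ^+ 2 * q).
  by rewrite /E0 /K; field; rewrite hq0 ha3 ha4.
have -> : x1 * (x1 - x3 * x4 / x2) = x1 ^+ 2 - x1 * x3 * x4 / x2.
  by rewrite mulrBr !mulrA expr2.
exact: balanced_qpoch_abel_sum.
Qed.
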